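(* Let $\mathcal H$ be a reproducing kernel Hilbert space of functions on a region $\mathcal E\subset\mathbb C$ satisfying the standing assumptions listed in the context, and let $f\in\mathcal H$. Let $(a_n)_{n\ge1}$ be a sequence in $\mathcal E$ selected according to the Maximal Selection Principle: for each $n\ge1$, there is a sequence $(b_j)_{j\ge1}$ in $\mathcal E\setminus\{a_1,\dots,a_{n-1}\}$ with $b_j\to a_n$ and $$\lim_{j\to\infty}|\langle f,B_n^{b_j}\rangle|=\sup\{|\langle f,B_n^a\rangle|\ :\ a\in\mathcal E\setminus\{a_1,\dots,a_{n-1}\}\}.$$ For each $n$ let $(B_1,\dots,B_n)$ be the Gram–Schmidt orthonormalization of $(\tilde k_{a_1},\dots,\tilde k_{a_n})$. Then, with convergence in the norm of $\mathcal H$, $$f=\sum_{n=1}^\infty\langle f,B_n\rangle B_n .$$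
   Context: Standing assumptions. $\mathcal E\subset\mathbb C$ is open and connected (possibly unbounded). $\mathcal H$ is a Hilbert space of holomorphic functions on $\mathcal E$ with reproducing kernel $k_a$, $a\in\mathcal E$, so $f(a)=\langle f,k_a\rangle$; the kernel $k_a$ is an analytic function of the variable $\overline a$, and $f^{(l)}(a)=\langle f,(\partial/\partial\overline a)^l k_a\rangle$ for all $f\in\mathcal H$, $a\in\mathcal E$, $l=1,2,\dots$. Multiplicities. For a finite or infinite sequence $a_1,a_2,\dots$ in $\mathcal E$ (repetitions allowed), $l(a_n)$ is the number of times the value $a_n$ occurs in the tuple $(a_1,\dots,a_n)$, and $$\tilde k_{a_n}=\Big[\Big(\frac{\partial}{\partial\overline a}\Big)^{l(a_n)-1}k_a\Big]_{a=a_n}.$$ It is assumed that the systems $(\tilde k_{a_1},\dots,\tilde k_{a_n})$ are linearly independent, so that Gram–Schmidt orthonormalization is defined. Given $a_1,\dots,a_{n-1}$ and the Gram–Schmidt orthonormalization $(B_1,\dots,B_{n-1})$ of $(\tilde k_{a_1},\dots,\tilde k_{a_{n-1}})$, for $a\in\mathcal E\setminus\{a_1,\dots,a_{n-1}\}$ let $B_n^a$ be such that $(B_1,\dots,B_{n-1},B_n^a)$ is the Gram–Schmidt orthonormalization of $(\tilde k_{a_1},\dots,\tilde k_{a_{n-1}},k_a)$, i.e. $$B_n^a=\frac{k_a-\sum_{k=1}^{n-1}\langle k_a,B_k\rangle B_k}{\|k_a-\sum_{k=1}^{n-1}\langle k_a,B_k\rangle B_k\|}.$$ Boundary vanishing condition: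 for every $n$, every such $a_1,\dots,a_{n-1}$ and every $f\in\mathcal H$, $\langle f,B_n^a\rangle\to0$ as $a\to\partial\mathcal E$, where the boundary is taken in the one-point compactification $\mathbb C\cup\{\infty\}$. (This guarantees that a selection of $a_n$ as required is possible at each step.) *)

(* Defs.v *)
From HB Require Import structures.
From mathcomp Require Import all_boot all_order all_algebra.
From mathcomp Require Import all_classical all_reals all_analysis.
From mathcomp Require Import complex.

Set Implicit Arguments.
Unset Strict Implicit.
Unset Printing Implicit Defensive.

Import Order.TTheory GRing.Theory Num.Theory.
Import numFieldNormedType.Exports.
Import ComplexField.Normc.

Local Open Scope classical_set_scope.
Local Open Scope ring_scope.

(* Packaging R[i] as a [numFieldType] gives it, through the instances that every
   numFieldType carries, the topology and normed module structure of its
   modulus (R[i] itself has no such instances). *)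
Definition Cplx (R : realType) : numFieldType := R[i].

Section HilbertSpace.
Context {R : realType} {H : completeNormedModType (Cplx R)}.

(* [dot u v] is linear in [u] and conjugate-linear in [v]. A Hilbert space is a
   complete normed space over [Cplx R] whose norm is induced by such a form. *)
Definition induces_norm (dot : {dot H for Num.conj}) : Prop :=
  forall u : H, `|u| ^+ 2 = dot u u.

Definition lin_indep (s : seq H) : Prop :=
  forall c : 'I_(size s) -> Cplx R,
    \sum_(i < size s) c i *: s`_i = 0 -> forall i, c i = 0.

Definition gs_step (dot : {dot H for Num.conj}) (Bs : seq H) (v : H) : H :=
  let r := v - \sum_(b <- Bs) dot v b *: b in `|r|^-1 *: r.

Definition gram_schmidt (dot : {dot H for Num.conj}) (s : seq H) : seq H :=
  foldl (fun Bs v => rcons Bs (gs_step dot Bs v)) [::] s.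

End HilbertSpace.

Section AnalyticKernel.
Context {R : realType} {H : completeNormedModType (Cplx R)}.

Definition analytic_at (g : Cplx R -> H) (z : Cplx R) : Prop :=
  exists c : nat -> H,
    \forall w \near z, series (fun n => (w - z) ^+ n *: c n) @ \oo --> g w.

(* For [k] analytic in the variable conj a: the value at [a] of the [l]-th
   derivative of [k] with respect to conj a, i.e. the [l]-th complex derivative
   of z |-> k (conj z) at z = conj a. *)
Definition dbar (k : Cplx R -> H) (l : nat) (a : Cplx R) : H :=
  derive1n l (fun z : Cplx R => k (Num.conj z)) (Num.conj a).

(* Elements of the abstract Hilbert space [H] are identified with functions on
   [E] through [ev], which is linear and injective; the values of [ev f] and [k]
   outside [E] are irrelevant. *)
Record analytic_rkhs (E : set (Cplx R)) (dot : {dot H for Num.conj})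
    (ev : H -> Cplx R -> Cplx R) (k : Cplx R -> H) : Prop := AnalyticRkhs {
  rkhs_norm : induces_norm dot ;
  rkhs_linear : forall (c : Cplx R) (f g : H) (a : Cplx R), E a ->
    ev (c *: f + g) a = c * ev f a + ev g a ;
  rkhs_inj : forall f g : H, (forall a, E a -> ev f a = ev g a) -> f = g ;
  rkhs_holomorphic : forall (f : H) (a : Cplx R), E a -> derivable (ev f) a 1 ;
  rkhs_reproducing : forall (f : H) (a : Cplx R), E a -> ev f a = dot f (k a) ;
  rkhs_kernel_analytic : forall a : Cplx R, E a ->
    analytic_at (fun z => k (Num.conj z)) (Num.conj a) ;
  rkhs_derivatives : forall (f : H) (a : Cplx R) (l : nat), E a -> (0 < l)%N ->
    derive1n l (ev f) a = dot f (dbar k l a)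
}.

(* With 0-based indexing, the number of occurrences of [s`_n] among
   [s`_0, ..., s`_n]. *)
Definition multiplicity (s : seq (Cplx R)) (n : nat) : nat :=
  count_mem s`_n (take n.+1 s).

Definition ktilde (k : Cplx R -> H) (s : seq (Cplx R)) : seq H :=
  mkseq (fun n => dbar k (multiplicity s n).-1 s`_n) (size s).

Definition kernels_independent (E : set (Cplx R)) (k : Cplx R -> H) : Prop :=
  forall s : seq (Cplx R), {in s, forall x, E x} -> lin_indep (ktilde k s).

(* The vector B_n^a attached to s = (a_1, ..., a_{n-1}). *)
Definition next_B (dot : {dot H for Num.conj}) (k : Cplx R -> H)
    (s : seq (Cplx R)) (a : Cplx R) : H :=
  gs_step dot (gram_schmidt dot (ktilde k s)) (k a).

End AnalyticKernel.

Section Boundary.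
Context {R : realType}.

Definition sphere_boundary (E : set (Cplx R)) :
    set (one_point_compactification (Cplx R)) :=
  let A : set (one_point_compactification (Cplx R)) := Some @` E in
  closure A `\` interior A.

Definition to_boundary (E : set (Cplx R)) : set_system (Cplx R) :=
  filter_from (set_nbhs (sphere_boundary E)) (fun U => E `&` Some @^-1` U).

Definition boundary_vanishing (H : completeNormedModType (Cplx R)) (E : set (Cplx R))
    (dot : {dot H for Num.conj}) (k : Cplx R -> H) : Prop :=
  forall s : seq (Cplx R), {in s, forall x, E x} -> forall f : H,
    dot f (next_B dot k s a)
      @[a --> within (~` [set` s]) (to_boundary E)] --> (0 : Cplx R).

End Boundary.

Definition maximal_selection (R : realType) (H : completeNormedModType (Cplx R))
    (E : set (Cplx R)) (dot : {dot H for Num.conj}) (k : Cplx R -> H) (f : H)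
    (a : nat -> Cplx R) : Prop :=
  forall n : nat, let s := mkseq a n in
  exists b : nat -> Cplx R,
    [/\ forall j, (E `\` [set` s]) (b j),
        b j @[j --> \oo] --> a n &
        normc (dot f (next_B dot k s (b j))) @[j --> \oo] -->
        sup [set normc (dot f (next_B dot k s x)) | x in E `\` [set` s]]].

(* Main.v *)
(* Let S_N be the partial sums and Q_N = 1 - (projection onto span(B_1, ..., B_N)).
   By Bessel's inequality S_N converges, to g say, and <f, B_n> -> 0.  The maximal
   selection gives |<f, B_n>| = sup_x |<f, B_n^x>|: expanding the kernel at a_n in
   powers of conj(b) - conj(a_n), Q_{n-1} kills every term below order l(a_n) - 1,
   so Q_{n-1} k_b is (conj(b) - conj(a_n))^(l(a_n) - 1) times a vector converging to
   a nonzero multiple of Q_{n-1} k~_{a_n}, and normalization turns the scalar into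
   a phase.  Hence, for every x in E,
     |<f - S_{n-1}, k_x>| = |<f, Q_{n-1} k_x>| <= |<f, B_n>| |k_x| -> 0,
   so f - g vanishes on E. *)

Require Import Defs.
From HB Require Import structures.
From mathcomp Require Import all_boot all_order all_algebra.
From mathcomp Require Import all_classical all_reals all_analysis.
From mathcomp Require Import complex.
From mathcomp Require Import ring lra.

Set Implicit Arguments.
Unset Strict Implicit.
Unset Printing Implicit Defensive.

Import Order.TTheory GRing.Theory Num.Theory.
Import numFieldNormedType.Exports.
Import ComplexField.Normc.

Local Open Scope classical_set_scope.
Local Open Scope ring_scope.

(** * Norms with values in the reals *)

Section RealNorm.
Context {R : realType} {V : normedModType (Cplx R)}.
Implicit Types (u v : V) (c : Cplx R).

(* [`|v|] lies in the partially ordered field R[i]; [rnorm v] is the same number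
   in [R], whose order is total and complete. *)
Definition rnorm v : R := complex.Re (`|v| : R[i]).

Lemma rnormE v : `|v| = (rnorm v)%:C%C :> R[i].
Proof. by rewrite [RHS]RRe_real// normr_real. Qed.

Lemma rnorm_ge0 v : 0 <= rnorm v.
Proof. by rewrite -lecR -rnormE; exact: (@normr_ge0 (Cplx R)). Qed.

Lemma rnorm_eq0 v : (rnorm v == 0) = (v == 0).
Proof.
rewrite -(@normr_eq0 (Cplx R) V) -(inj_eq (@complexI R)) -rnormE; exact.
Qed.

Lemma rnorm0 : rnorm 0 = 0.
Proof. by apply/eqP; rewrite rnorm_eq0. Qed.

Lemma rnorm_gt0 v : (0 < rnorm v) = (v != 0).
Proof. by rewrite lt_def rnorm_eq0 rnorm_ge0 andbT. Qed.

Lemma rnormN v : rnorm (- v) = rnorm v.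
Proof. by rewrite /rnorm normrN. Qed.

Lemma rdistC u v : rnorm (u - v) = rnorm (v - u).
Proof. by rewrite -rnormN opprB. Qed.

Lemma rnormD u v : rnorm (u + v) <= rnorm u + rnorm v.
Proof.
rewrite -lecR rmorphD/= -!rnormE.
exact: (@ler_normD (Cplx R)).
Qed.

Lemma rnormZ c v : rnorm (c *: v) = normc c * rnorm v.
Proof.
by apply: (@complexI R); rewrite rmorphM/= -!rnormE [LHS]normrZ.
Qed.

Lemma rnorm_sum (I : Type) (r : seq I) (P : pred I) (F : I -> V) :
  rnorm (\sum_(i <- r | P i) F i) <= \sum_(i <- r | P i) rnorm (F i).
Proof.
elim/big_rec2: _ => [|i x y _ le_yx]; first by rewrite rnorm0.
by apply: le_trans (rnormD _ _) _; rewrite lerD2l.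
Qed.

(** Convergence quantifies over positive elements of [Cplx R]. Such elements are real, so it
    suffices to test radii in [R]. *)
Lemma cvg_rnormP (T : Type) (F : set_system T) {FF : Filter F} (g : T -> V) l :
  (g @ F --> l) <->
  (forall e : R, 0 < e -> \forall x \near F, rnorm (l - g x) < e).
Proof.
split=> [/cvgrPdist_lt cvg_g e e0|cvg_g].
  have := cvg_g (e%:C)%C; rewrite ltcR => /(_ e0); apply: filterS => x.
  have := ltcR (rnorm (l - g x)) e.
  rewrite -rnormE => <-; exact.
apply/cvgrPdist_lt => e e0.
have eE : (complex.Re (e : R[i]))%:C%C = e by rewrite RRe_real// gtr0_real.
have /cvg_g : 0 < complex.Re (e : R[i]) by rewrite -ltcR eE.
by apply: filterS => x; rewrite -ltcR -rnormE eE.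
Qed.

Lemma cvg_rnorm (T : Type) (F : set_system T) {FF : Filter F} (g : T -> V) l :
  g @ F --> l -> rnorm (g x) @[x --> F] --> rnorm l.
Proof.
move=> /cvg_rnormP cg; apply/cvgrPdist_lt => e /cg; apply: filterS => x.
apply: le_lt_trans.
have h1 := rnormD (l - g x) (g x); have h2 := rnormD (g x - l) l.
rewrite !subrK in h1 h2; rewrite rdistC in h2.
by rewrite ler_norml; lra.
Qed.

Lemma near_rnormP (v : V) (P : set V) :
  (\forall x \near v, P x) <->
  exists2 e : R, 0 < e & forall x, rnorm (x - v) < e -> P x.
Proof.
split=> [/nbhs_normP[e /= e0 eP]|[e e0 eP]].
  have eE : (complex.Re (e : R[i]))%:C%C = e by rewrite RRe_real// gtr0_real.
  exists (complex.Re (e : R[i])); first by rewrite -ltcR eE.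
  by move=> x; rewrite -ltcR -rnormE eE distrC => xv; apply: eP.
apply/nbhs_normP; exists (e%:C)%C => /=; first by rewrite ltcR.
by move=> x /= xv; apply: eP; rewrite -ltcR -rnormE distrC.
Qed.

End RealNorm.

(** * The modulus on the complex plane *)

Section Complex.
Context {R : realType}.
Implicit Types (x y : Cplx R).

Lemma rnorm_normc x : rnorm x = normc x.
Proof. by rewrite /rnorm; change (complex.Re `|x : R[i]| = normc x); rewrite normc_def; case: x. Qed.

Lemma normc_ge0 x : 0 <= normc x.
Proof. by rewrite -rnorm_normc rnorm_ge0. Qed.

Lemma normc_gt0 x : (0 < normc x) = (x != 0).
Proof. by rewrite -rnorm_normc rnorm_gt0. Qed.

Lemma normcX x n : normc (x ^+ n) = normc x ^+ n.
Proof.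
by elim: n => [|n IH]; rewrite ?normc1// !exprS normcM IH.
Qed.

Lemma normc_conj x : normc (Num.conj x) = normc x.
Proof.
by rewrite -!rnorm_normc /rnorm; congr complex.Re; exact: (@norm_conjC R[i]).
Qed.

Lemma normc_rnorm {V : normedModType (Cplx R)} (v : V) : normc `|v| = rnorm v.
Proof. by rewrite -rnorm_normc /rnorm [in LHS]normr_id. Qed.

Lemma cvg_normc (T : Type) (F : set_system T) {FF : Filter F}
    (g : T -> Cplx R) (l : Cplx R) :
  g @ F --> l -> normc (g x) @[x --> F] --> normc l.
Proof.
move=> /cvg_rnorm; rewrite rnorm_normc.
by under eq_fun do rewrite rnorm_normc.
Qed.

Lemma cvg_conj (x : Cplx R) (T : Type) (F : set_system T) {FF : Filter F}
    (g : T -> Cplx R) :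
  g @ F --> x -> Num.conj (g y) @[y --> F] --> Num.conj x.
Proof.
move=> /cvg_rnormP cg; apply/cvg_rnormP => e /cg; apply: filterS => y.
by rewrite !rnorm_normc -rmorphB normc_conj.
Qed.

Lemma near_normcP (z : Cplx R) (P : set (Cplx R)) :
  (\forall x \near z, P x) <->
  exists2 e : R, 0 < e & forall x, normc (x - z) < e -> P x.
Proof.
split=> [/near_rnormP[e e0 eP]|[e e0 eP]].
  by exists e => // x; rewrite -rnorm_normc; exact: eP.
apply/near_rnormP; exists e => // x; rewrite rnorm_normc; exact: eP.
Qed.

Lemma near_dnbhs_normc (z : Cplx R) (P : set (Cplx R)) (e : R) : 0 < e ->
  (forall x, x != z -> normc (x - z) < e -> P x) -> \forall x \near z^', P x.
Proof.
move=> e0 eP; rewrite /dnbhs /within /prop_near1 /=; apply/near_normcP.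
by exists e => // x xz /= x_neq; exact: eP.
Qed.

End Complex.

(** * Power series with coefficients in a complex Banach space *)

Section RealGeometric.
Context {R : realType}.
Implicit Types (q : R).

Lemma geometric_sum_le q n : 0 <= q -> q < 1 ->
  \sum_(0 <= i < n) q ^+ i <= (1 - q)^-1.
Proof.
move=> q0 q1; have q1' : 0 < 1 - q by rewrite subr_gt0.
have E : (1 - q) * \sum_(0 <= i < n) q ^+ i = 1 - q ^+ n.
  elim: n => [|n IH]; first by rewrite big_nil expr0; ring.
  by rewrite big_nat_recr//= mulrDr IH exprS; ring.
rewrite -(ler_pM2l q1') E divff ?gt_eqF// gerBl exprn_ge0//.
Qed.

(** Each of the [n + 1] terms [q ^+ i] with [i <= n] is at least [q ^+ n], so the left side is at
    most a partial geometric sum. *)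
Lemma natr_geometric_le q n : 0 <= q -> q < 1 ->
  n.+1%:R * q ^+ n <= (1 - q)^-1.
Proof.
move=> q0 q1; apply: le_trans (geometric_sum_le n.+1 q0 q1).
rewrite big_mkord mulr_natl -[X in _ *+ X]card_ord -sumr_const.
by apply: ler_sum => i _; rewrite ler_wiXn2l// ?ltW// -ltnS.
Qed.

End RealGeometric.

(** * Series dominated by a geometric series *)

Section Series.
Context {R : realType} {V : completeNormedModType (Cplx R)}.
Implicit Types (u : nat -> V).

Lemma rnorm_cauchy_cvg u :
  (forall e : R, 0 < e ->
     exists N, forall n, (N <= n)%N -> rnorm (u n - u N) < e) ->
  cvgn u.
Proof.
move=> cu; apply: cauchy_cvg; apply: cauchy_exP => e e0.
have eE : (complex.Re (e : R[i]))%:C%C = e by rewrite RRe_real// gtr0_real.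
have /cu[N uN] : 0 < complex.Re (e : R[i]) by rewrite -ltcR eE.
exists (u N); exists N => // n /= /uN.
by rewrite -ball_normE /= distrC -ltcR -rnormE eE.
Qed.

Lemma rnorm_cvg_le (T : Type) (F : set_system T) {FF : ProperFilter F}
    (g : T -> V) (l : V) (M : R) :
  g @ F --> l -> (\forall x \near F, rnorm (g x) <= M) -> rnorm l <= M.
Proof.
move=> /cvg_rnormP cg gM; rewrite leNgt; apply/negP => Ml.
have /cg cg' : 0 < rnorm l - M by rewrite subr_gt0.
have [x []] := filter_ex (filterI cg' gM).
have := rnormD (l - g x) (g x); rewrite subrK; lra.
Qed.

Lemma geometric_series_le u (M q : R) : 0 <= q -> q < 1 ->
  (forall n, rnorm (u n) <= M * q ^+ n) ->
  forall n, rnorm (series u n) <= M * (1 - q)^-1.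
Proof.
move=> q0 q1 uM n; apply: le_trans (rnorm_sum _ _ _) _.
have M0 : 0 <= M by have := uM 0; rewrite mulr1; apply: le_trans (rnorm_ge0 _).
apply: le_trans (ler_wpM2l M0 (geometric_sum_le n q0 q1)).
by rewrite mulr_sumr; apply: ler_sum.
Qed.

Lemma is_cvg_dominated_series u (M q : R) : 0 <= q -> q < 1 ->
  (forall n, rnorm (u n) <= M * q ^+ n) -> cvgn (series u).
Proof.
move=> q0 q1 uM; apply: rnorm_cauchy_cvg => e e0.
have : geometric (M * (1 - q)^-1) q @ \oo --> (0 : R).
  by apply: cvg_geometric; rewrite ger0_norm.
move=> /cvgrPdist_lt/(_ _ e0)[N _ /(_ N (leqnn _))] /=.
rewrite sub0r normrN => hN; exists N => n Nn.
rewrite sub_series_geq// (le_lt_trans _ hN)// (le_trans _ (ler_norm _))//.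
rewrite -{1}(add0n N) big_addn.
(* The tail from [N] on, reindexed at 0, is dominated by a geometric series with constant
   [M * q ^+ N]; its bound was made smaller than [e] by the choice of [N]. *)
apply: le_trans (geometric_series_le q0 q1 (M := M * q ^+ N) _ (n - N)) _.
  by move=> i; rewrite /= (le_trans (uM _))// exprD mulrA mulrAC.
by rewrite mulrAC.
Qed.

End Series.

(** * Termwise differentiation and Taylor expansion *)

Section PowerSeries.
Context {R : realType} {V : completeNormedModType (Cplx R)}.
Implicit Types (c : nat -> V) (z h w : Cplx R) (r s M : R).

(** For a divergent series [limn] is a default value; the sum is meaningful under a [coef_bound]
    with radius larger than [normc z]. *)
Definition psum c z : V := limn (series (fun n => z ^+ n *: c n)).

(** A Cauchy estimate used in place of a radius of convergence: it yields explicit geometric bounds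
    and passes to shifted and differentiated series. *)
Definition coef_bound c r M := forall n, rnorm (c n) * r ^+ n <= M.

Lemma coef_bound_term c r M z : 0 < r -> coef_bound c r M ->
  forall n, rnorm (z ^+ n *: c n) <= M * (normc z / r) ^+ n.
Proof.
move=> r0 cM n; rewrite rnormZ normcX expr_div_n mulrA.
rewrite ler_pdivlMr ?exprn_gt0// mulrC mulrCA [M * _]mulrC mulrA -mulrA.
by rewrite [r ^+ _ * _]mulrC ler_wpM2l// ?exprn_ge0 ?normc_ge0.
Qed.

Lemma ratio_lt1 r z : normc z < r -> 0 <= normc z / r < 1.
Proof.
move=> zr; have r0 : 0 < r by apply: le_lt_trans zr; exact: normc_ge0.
by rewrite divr_ge0 ?normc_ge0 ?(ltW r0)//= ltr_pdivrMr// mul1r.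
Qed.

Lemma psum_cvg c r M z : coef_bound c r M -> normc z < r ->
  series (fun n => z ^+ n *: c n) @ \oo --> psum c z.
Proof.
move=> cM zr; have r0 : 0 < r by apply: le_lt_trans zr; exact: normc_ge0.
have /andP[q0 q1] := ratio_lt1 zr.
exact: is_cvg_dominated_series q0 q1 (coef_bound_term _ r0 cM).
Qed.

Lemma psum_le c r M z : coef_bound c r M -> normc z < r ->
  rnorm (psum c z) <= M * (1 - normc z / r)^-1.
Proof.
move=> cM zr; have r0 : 0 < r by apply: le_lt_trans zr; exact: normc_ge0.
have /andP[q0 q1] := ratio_lt1 zr.
apply: (rnorm_cvg_le (psum_cvg cM zr)); apply: nearW.
exact: geometric_series_le (coef_bound_term _ r0 cM).
Qed.

Lemma coef_bound_shift c r M : 0 < r -> coef_bound c r M ->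
  coef_bound (c \o S) r (M / r).
Proof. by move=> r0 cM n /=; rewrite ler_pdivlMr// -mulrA -exprSr. Qed.

Lemma psum_shift c r M z : coef_bound c r M -> normc z < r ->
  psum c z = c 0 + z *: psum (c \o S) z.
Proof.
move=> cM zr; have r0 : 0 < r by apply: le_lt_trans zr; exact: normc_ge0.
apply: cvg_lim; first exact: norm_hausdorff.
rewrite -(cvg_shiftS (series _)).
have -> : (fun n => series (fun n => z ^+ n *: c n) n.+1) =
    (fun n => c 0 + z *: series (fun n => z ^+ n *: (c \o S) n) n).
  apply/funext => n; rewrite !seriesEnat/= big_nat_recl// expr0 scale1r.
  by rewrite scaler_sumr; congr (_ + _); apply: eq_bigr => i _; rewrite scalerA exprS.
apply: cvgD; first exact: cvg_cst.
apply: cvgZl_tmp.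
exact: psum_cvg (coef_bound_shift r0 cM) zr.
Qed.

Definition dcoef c : nat -> V := fun n => n.+1%:R *: c n.+1.

(** Shrinking the radius from [r] to [s] leaves a factor [(s / r) ^+ n], which absorbs the factor
    [n + 1] by [natr_geometric_le]. *)
Lemma coef_bound_dcoef c r s M : 0 <= s -> s < r -> coef_bound c r M ->
  coef_bound (dcoef c) s (M / r * (1 - s / r)^-1).
Proof.
move=> s0 sr cM n; have r0 : 0 < r by apply: le_lt_trans sr.
rewrite /dcoef rnormZ normcMn normc1.
have -> : n.+1%:R * rnorm (c n.+1) * s ^+ n =
    rnorm (c n.+1) * r ^+ n.+1 / r * (n.+1%:R * (s / r) ^+ n).
  have r_neq0 : r != 0 by rewrite gt_eqF.
  have rn_neq0 : r ^+ n != 0 by rewrite expf_neq0.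
  by rewrite expr_div_n exprS; field; apply/andP.
have M0 : 0 <= M.
  by apply: le_trans (cM n); rewrite mulr_ge0 ?rnorm_ge0 ?exprn_ge0// ltW.
apply: ler_pM.
- by rewrite divr_ge0 ?mulr_ge0 ?exprn_ge0 ?rnorm_ge0// ltW.
- by rewrite mulr_ge0// exprn_ge0// divr_ge0// ltW.
- by rewrite ler_pM2r ?invr_gt0.
- by apply: natr_geometric_le; rewrite ?divr_ge0 ?ltr_pdivrMr ?mul1r// ltW.
Qed.

(** Multiplying the remainder for one exponent by [z + h] gives the remainder for the next, up to a
    single term in [h ^+ 2]. The constant is twice the sharp one, and is exactly the factor produced
    by applying [dcoef] twice. *)
Lemma expr_taylor1_le z h (rho : R) n :
  normc z <= rho -> normc (z + h) <= rho ->
  normc ((z + h) ^+ n.+2 - z ^+ n.+2 - n.+2%:R * h * z ^+ n.+1) <=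
  normc h ^+ 2 * ((n.+2)%:R * n.+1%:R * rho ^+ n).
Proof.
move=> z_le zh_le; have rho0 : 0 <= rho by apply: le_trans z_le; exact: normc_ge0.
elim: n => [|n IH].
  have -> : (z + h) ^+ 2 - z ^+ 2 - 2%:R * h * z ^+ 1 = h ^+ 2 by ring.
  rewrite normcX expr0 ler_peMr ?exprn_ge0 ?normc_ge0//; lra.
have -> : (z + h) ^+ n.+3 - z ^+ n.+3 - n.+3%:R * h * z ^+ n.+2 =
    (z + h) * ((z + h) ^+ n.+2 - z ^+ n.+2 - n.+2%:R * h * z ^+ n.+1)
    + n.+2%:R * h ^+ 2 * z ^+ n.+1.
  by rewrite -[n.+3%:R]natr1 !exprS; ring.
apply: le_trans (le_normcD _ _) _.
rewrite !normcM !normcX normcMn normc1.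
have h1 : normc (z + h) *
    normc ((z + h) ^+ n.+2 - z ^+ n.+2 - n.+2%:R * h * z ^+ n.+1) <=
    rho * (normc h ^+ 2 * (n.+2%:R * n.+1%:R * rho ^+ n)).
  by apply: ler_pM; rewrite ?normc_ge0.
have h2 : n.+2%:R * normc h ^+ 2 * normc z ^+ n.+1 <=
    n.+2%:R * normc h ^+ 2 * rho ^+ n.+1.
  by rewrite ler_wpM2l ?mulr_ge0 ?exprn_ge0 ?normc_ge0// lerXn2r ?nnegrE ?normc_ge0.
apply: le_trans (lerD h1 h2) _.
(* The two constants add up to [(n + 2)^2], which is at most [(n + 3)(n + 2)]. *)
have -> : rho * (normc h ^+ 2 * (n.+2%:R * n.+1%:R * rho ^+ n)) +
  n.+2%:R * normc h ^+ 2 * rho ^+ n.+1 =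
  normc h ^+ 2 * (n.+2%:R * n.+2%:R * rho ^+ n.+1).
  by rewrite (exprS rho n) -[n.+2%:R]natr1; ring.
rewrite ler_wpM2l ?exprn_ge0 ?normc_ge0// ler_wpM2r ?exprn_ge0//.
by rewrite ler_wpM2r// ler_nat.
Qed.

(** Summing [expr_taylor1_le] against the coefficients leaves a series governed by the bound on
    [dcoef (dcoef c)], with ratio [rho / s]. *)
Lemma psum_taylor1_le c (s rho M0 M1 M2 : R) z h :
  coef_bound c s M0 -> coef_bound (dcoef c) s M1 ->
  coef_bound (dcoef (dcoef c)) s M2 ->
  rho < s -> normc z <= rho -> normc (z + h) <= rho ->
  rnorm (psum c (z + h) - psum c z - h *: psum (dcoef c) z) <=
  normc h ^+ 2 * M2 * (1 - rho / s)^-1.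
Proof.
move=> cM0 cM1 cM2 rs z_le zh_le.
have rho0 : 0 <= rho by apply: le_trans z_le; exact: normc_ge0.
have s0 : 0 < s by apply: le_lt_trans rs.
have zs := le_lt_trans z_le rs; have zhs := le_lt_trans zh_le rs.
pose e n := ((z + h) ^+ n.+2 - z ^+ n.+2 - n.+2%:R * h * z ^+ n.+1) *: c n.+2.
(* Exponents 0 and 1 contribute nothing to the remainder, and the derivative series lags by one
   exponent; hence the lengths [n + 2] and [n + 1] against [n] terms of [e]. *)
pose T n := series (fun n => (z + h) ^+ n *: c n) n.+2
  - series (fun n => z ^+ n *: c n) n.+2
  - h *: series (fun n => z ^+ n *: dcoef c n) n.+1.
have cT : T @ \oo --> psum c (z + h) - psum c z - h *: psum (dcoef c) z.
  apply: cvgB; first apply: cvgB.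
  - have := psum_cvg cM0 zhs; rewrite -(cvg_shiftn 2).
    by under eq_fun do rewrite addn2.
  - have := psum_cvg cM0 zs; rewrite -(cvg_shiftn 2).
    by under eq_fun do rewrite addn2.
  - apply: cvgZl_tmp; have := psum_cvg cM1 zs; rewrite -(cvg_shiftn 1).
    by under eq_fun do rewrite addn1.
apply: (rnorm_cvg_le cT); apply: nearW => n.
have -> : T n = series e n.
  elim: n => [|n IH].
    rewrite /T !seriesEnat/= !big_nat_recr//= !big_nil /dcoef.
    rewrite !expr0 !expr1 !scale1r !add0r scalerDl.
    by rewrite addrA [c 0 + _ + _]addrC addrK subrr.
  rewrite [RHS]seriesSr -IH /T /e.
  rewrite (seriesSr _ n.+2) (seriesSr (fun n => z ^+ n *: c n) n.+2).
  rewrite (seriesSr (fun n => z ^+ n *: dcoef c n) n.+1) /dcoef.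
  have -> : n.+2%:R * h * z ^+ n.+1 = h * z ^+ n.+1 * n.+2%:R by ring.
  rewrite !scalerBl scalerDr !scalerA.
  by rewrite !opprD [X in X + _ = _]addrACA [LHS]addrACA.
apply: geometric_series_le; rewrite ?divr_ge0 ?ltr_pdivrMr ?mul1r// ?(ltW s0)//.
move=> i; rewrite rnormZ.
apply: le_trans (ler_wpM2r (rnorm_ge0 _) (expr_taylor1_le i z_le zh_le)) _.
have := cM2 i; rewrite /dcoef !rnormZ !normcMn !normc1 => hM.
rewrite -[leLHS]mulrA -[leRHS]mulrA ler_wpM2l ?exprn_ge0 ?normc_ge0//.
rewrite expr_div_n [leRHS]mulrA ler_pdivlMr ?exprn_gt0//.
rewrite [leRHS]mulrC.
apply: le_trans (ler_wpM2l (exprn_ge0 i rho0) hM).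
by rewrite le_eqVlt; apply/orP; left; apply/eqP; ring.
Qed.

Lemma coef_bound_le c s r M : 0 <= s -> s <= r -> coef_bound c r M ->
  coef_bound c s M.
Proof.
move=> s0 sr cM n; apply: le_trans (cM n).
by rewrite ler_wpM2l ?rnorm_ge0// lerXn2r ?nnegrE// (le_trans s0).
Qed.

Lemma derive1_psum c r M (F : Cplx R -> V) z :
  coef_bound c r M ->
  (forall w, normc (w - z) < r -> F w = psum c (w - z)) ->
  forall w, normc (w - z) < r -> derive1 F w = psum (dcoef c) (w - z).
Proof.
move=> cM FE w wr.
pose t := normc (w - z); have t0 : 0 <= t := normc_ge0 _.
(* The interval from [t] to [r] is cut into quarters: the first derivative is bounded at [s'], the
   second at [s], and [rho] leaves room for the increment [h]. *)
pose rho := (3 * t + r) / 4; pose s := (t + r) / 2; pose s' := (t + 3 * r) / 4.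
have [tr rs ss' s'r] : [/\ t < rho, rho < s, s < s' & s' < r].
  by rewrite /rho /s /s'; split; move: wr; rewrite -/t; lra.
have [s0 s'0] : 0 <= s /\ 0 <= s' by rewrite /s /s'; split; move: wr; rewrite -/t; lra.
have cM0 : coef_bound c s M by apply: coef_bound_le cM; lra.
have cM1' := coef_bound_dcoef s'0 s'r cM.
have cM1 := coef_bound_le s0 (ltW ss') cM1'.
have cM2 := coef_bound_dcoef s0 ss' cM1'.
set M2 := (X in coef_bound (dcoef (dcoef c)) s X) in cM2.
pose C := M2 * (1 - rho / s)^-1.
apply: cvg_lim; first exact: norm_hausdorff.
apply/cvg_rnormP => e e0.
(* The first bound keeps the shifted point within [rho]; the second makes [normc h * C < e], the
   [1 +] avoiding a division by zero. *)
have d0 : 0 < Num.min (rho - t) (e / (1 + `|C|)).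
  by rewrite lt_min subr_gt0 tr/= divr_gt0// ltr_pwDl.
apply: (near_dnbhs_normc d0) => h h_neq0.
rewrite subr0.
rewrite lt_min => /andP[h_rho h_e].
have whz : h + w - z = (w - z) + h by rewrite -addrA addrC.
have zh_le : normc ((w - z) + h) <= rho.
  by apply: le_trans (le_normcD _ _) _; rewrite -/t; lra.
have := psum_taylor1_le cM0 cM1 cM2 rs (ltW tr) zh_le.
rewrite -FE// -whz -FE; last by rewrite whz; lra.
rewrite -[_ * M2 * _]mulrA -/C => T.
have nh0 : 0 < normc h by rewrite normc_gt0.
have -> : psum (dcoef c) (w - z) - h^-1 *: (F (h + w) - F w) =
    - (h^-1 *: (F (h + w) - F w - h *: psum (dcoef c) (w - z))).
  by rewrite [in RHS]scalerBr scalerA mulVf// scale1r opprB.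
rewrite rnormN rnormZ normcV mulrC ltr_pdivrMr//.
apply: le_lt_trans T _; rewrite expr2 -mulrA mulrC ltr_pM2r//.
apply: le_lt_trans (ler_wpM2l (ltW nh0) (ler_norm C)) _.
move: h_e; rewrite ltr_pdivlMr ?ltr_pwDl// mulrDr mulr1.
by apply: le_lt_trans; rewrite lerDr ltW.
Qed.

Lemma psum0 c r M : 0 < r -> coef_bound c r M -> psum c 0 = c 0.
Proof.
move=> r0 cM.
by rewrite (psum_shift cM) ?scale0r ?addr0// -rnorm_normc rnorm0.
Qed.

(** The induction replaces [F] by its derivative and [c] by [dcoef c], halving the radius. This is
    why the hypothesis concerns a whole disc and not only the point [z]. *)
Lemma derive1n_psum m c r M (F : Cplx R -> V) z : 0 < r ->
  coef_bound c r M ->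
  (forall w, normc (w - z) < r -> F w = psum c (w - z)) ->
  derive1n m F z = m`!%:R *: c m.
Proof.
elim: m c r M F => [|m IH] c r M F r0 cM FE.
  rewrite derive1n0 FE subrr ?(psum0 r0 cM) ?scale1r//.
  by rewrite -rnorm_normc rnorm0.
have r20 : 0 < r / 2 by rewrite divr_gt0.
have r2r : r / 2 < r by lra.
rewrite derive1Sn (IH _ (r / 2) _ _ r20 (coef_bound_dcoef (ltW r20) r2r cM)).
  by rewrite /dcoef scalerA -natrM factS mulnC.
by move=> w wr; rewrite (derive1_psum cM FE)//; lra.
Qed.

(** Abel's argument: convergence at the one point [z + h] with [normc h = e / 2] makes the terms
    [h ^+ n *: c n] bounded, which is a [coef_bound] of radius [e / 2]. *)
Lemma analytic_at_psum (g : Cplx R -> V) z : analytic_at g z ->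
  exists c r M, [/\ 0 < r, coef_bound c r M &
    forall w, normc (w - z) < r -> g w = psum c (w - z)].
Proof.
move=> [c /near_normcP[e e0 gE]].
pose h : Cplx R := ((e / 2)%:C)%C.
have hE : normc h = e / 2 by rewrite /h /normc/= expr0n/= addr0 sqrtr_sqr ger0_norm// divr_ge0// ltW.
have e20 : 0 < e / 2 by rewrite divr_gt0.
have /gE/cvgP/cvg_series_cvg_0 : rnorm (z + h - z) < e.
  by rewrite addrC addKr rnorm_normc hE; lra.
rewrite addrC addKr => /cvg_rnormP c0.
have : (fun n => rnorm (h ^+ n *: c n)) @ \oo --> (0 : R).
  apply/cvgrPdist_lt => d /c0; apply: filterS => n.
  by rewrite !sub0r rnormN normrN ger0_norm ?rnorm_ge0.
move=> /cvgP/cvg_seq_bounded/bounded_fun_has_ubound[M M_ub].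
have cM : coef_bound c (e / 2) M.
  by move=> n; rewrite mulrC -hE -normcX -rnormZ; apply: M_ub; exists n.
exists c, (e / 2), M; split => // w we.
have /gE cw : rnorm (w - z) < e by rewrite rnorm_normc; lra.
by apply/esym; apply: cvg_lim cw; exact: norm_hausdorff.
Qed.

(** [G] is the power series of the coefficients from index [m] on. It tends to its constant term
    because [psum_shift] writes the difference as [w - z] times a bounded sum. *)
Lemma analytic_taylor (g : Cplx R -> V) z m : analytic_at g z ->
  exists G : Cplx R -> V,
    G w @[w --> z] --> m`!%:R^-1 *: derive1n m g z /\
    \forall w \near z, g w =
      \sum_(i < m) ((w - z) ^+ i / i`!%:R) *: derive1n i g z + (w - z) ^+ m *: G w.
Proof.
move=> /analytic_at_psum[c [r [M [r0 cM gE]]]].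
have dE i := derive1n_psum i r0 cM gE.
have fact_neq0 i : (i`!%:R : Cplx R) != 0 by rewrite pnatr_eq0 -lt0n fact_gt0.
have shiftM n : exists M', coef_bound (fun i => c (n + i)%N) r M'.
  elim: n => [|n [M' IH]]; first by exists M.
  exists (M' / r) => i; rewrite addSnnS; exact: (coef_bound_shift r0 IH).
exists (fun w => psum (fun i => c (m + i)%N) (w - z)); split.
  have [M' cM'] := shiftM m.
  rewrite dE scalerA mulVf// scale1r.
  have r20 : 0 < r / 2 by rewrite divr_gt0.
  (* On the half disc the ratio [normc (w - z) / r] is at most 1/2, so [C] bounds the once more
     shifted series there. *)
  pose C := M' / r * (1 - 2^-1)^-1.
  apply/(@cvg_rnormP _ _ _ (nbhs z)) => e e0; apply/near_normcP.
  exists (Num.min (r / 2) (e / (1 + `|C|))).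
    by rewrite lt_min r20 divr_gt0// ltr_pwDl.
  move=> w; rewrite lt_min => /andP[w_r w_e].
  have wr : normc (w - z) < r by lra.
  rewrite (psum_shift cM' wr) addn0 opprD addrA subrr add0r rnormN rnormZ.
  have C0 : 0 <= M' / r.
    rewrite divr_ge0 ?(ltW r0)//; apply: le_trans (cM' 0).
    by rewrite mulr_ge0 ?rnorm_ge0 ?exprn_ge0// ltW.
  have : rnorm (psum ((fun i => c (m + i)%N) \o S) (w - z)) <= `|C|.
    apply: le_trans (psum_le (coef_bound_shift r0 cM') wr) _.
    apply: le_trans (ler_norm C); apply: ler_wpM2l => //.
    rewrite lef_pV2 ?posrE ?subr_gt0 ?ltr_pdivrMr ?mul1r ?invf_lt1 ?ltr1n//.
    by rewrite lerD2l lerN2 ler_pdivrMr//; lra.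
  move=> /(ler_wpM2l (normc_ge0 (w - z))) /le_lt_trans; apply.
  move: w_e; rewrite ltr_pdivlMr ?ltr_pwDl// mulrDr mulr1.
  by apply: le_lt_trans; rewrite lerDr normc_ge0.
apply/near_normcP; exists r => // w wr.
rewrite gE//.
under eq_bigr => i _ do rewrite dE scalerA divfK//.
elim: m => [|m ->]; first by rewrite big_ord0 add0r expr0 scale1r.
have [M' cM'] := shiftM m.
rewrite (psum_shift cM' wr) big_ord_recr/= addn0 scalerDr scalerA -exprSr addrA.
by congr (_ + _ *: psum _ _); apply/funext => i /=; rewrite addSnnS.
Qed.

End PowerSeries.

(** * Orthonormal systems and Gram-Schmidt *)

Section Dot.
Context {R : realType} {H : completeNormedModType (Cplx R)}.
Context (dot : {dot H for Num.conj}) (dot_norm : induces_norm dot).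
Implicit Types (u v w : H) (c : Cplx R).

Lemma dotC u v : dot u v = Num.conj (dot v u).
Proof. by rewrite (hermC dot u v) expr0 mul1r. Qed.

Lemma dot0l v : dot 0 v = 0.
Proof. exact: linear0l. Qed.

Lemma dotDl u v w : dot (u + v) w = dot u w + dot v w.
Proof. exact: linearDl. Qed.

Lemma dotBl u v w : dot (u - v) w = dot u w - dot v w.
Proof. exact: linearBl. Qed.

Lemma dotZl c u w : dot (c *: u) w = c * dot u w.
Proof. exact: linearZl_LR. Qed.

Lemma dot_suml (I : Type) (r : seq I) (P : pred I) (F : I -> H) w :
  dot (\sum_(i <- r | P i) F i) w = \sum_(i <- r | P i) dot (F i) w.
Proof.
by elim/big_rec2: _ => [|i x y _ <-]; rewrite ?dot0l// dotDl.
Qed.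

Lemma dotBr u v w : dot u (v - w) = dot u v - dot u w.
Proof. by rewrite dotC dotBl rmorphB/= -!dotC. Qed.

Lemma dotZr c u w : dot u (c *: w) = Num.conj c * dot u w.
Proof. by rewrite dotC dotZl rmorphM/= -dotC. Qed.

Lemma dot_sumr (I : Type) (r : seq I) (P : pred I) (F : I -> H) w :
  dot w (\sum_(i <- r | P i) F i) = \sum_(i <- r | P i) dot w (F i).
Proof.
by rewrite dotC dot_suml rmorph_sum/=; apply: eq_bigr => i _; rewrite -dotC.
Qed.

Lemma dot_rnorm u : dot u u = (rnorm u ^+ 2)%:C%C.
Proof. by rewrite -dot_norm rmorphXn/= -rnormE. Qed.

Lemma rnorm_pythagoras u v : dot u v = 0 ->
  rnorm (u + v) ^+ 2 = rnorm u ^+ 2 + rnorm v ^+ 2.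
Proof.
move=> uv0; have vu0 : dot v u = 0 by rewrite dotC uv0 rmorph0.
apply: (@complexI R); rewrite rmorphD/= -!dot_rnorm.
rewrite dotDl [dot u (u + v)]dotC [dot v (u + v)]dotC !dotDl !rmorphD/= -!dotC.
by rewrite uv0 vu0 addr0 add0r.
Qed.

(** Pythagoras for the splitting of [u] into its component along [v] and the rest. *)
Lemma dot_unit_le u v : rnorm v = 1 -> normc (dot u v) <= rnorm u.
Proof.
move=> v1; have vv : dot v v = 1 by rewrite dot_rnorm v1 expr1n.
have : rnorm (u - dot u v *: v + dot u v *: v) ^+ 2 =
    rnorm (u - dot u v *: v) ^+ 2 + rnorm (dot u v *: v) ^+ 2.
  by apply: rnorm_pythagoras; rewrite dotZr dotBl dotZl vv mulr1 subrr mulr0.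
rewrite subrK rnormZ v1 mulr1 => E.
rewrite -(@ler_pXn2r _ 2) ?nnegrE ?normc_ge0 ?rnorm_ge0// E.
by rewrite lerDr sqr_ge0.
Qed.

Lemma cauchy_schwarz u v : normc (dot u v) <= rnorm u * rnorm v.
Proof.
have [->|v0] := eqVneq v 0; first by rewrite dotC dot0l rmorph0 normc0 rnorm0 mulr0.
have nv0 : 0 < rnorm v by rewrite rnorm_gt0.
have vE : normc `|v| = rnorm v by rewrite normc_rnorm.
have /(dot_unit_le u) : rnorm (`|v|^-1 *: v) = 1.
  by rewrite rnormZ normcV vE mulVf// gt_eqF.
by rewrite dotZr normcM normc_conj normcV vE mulrC ler_pdivrMr.
Qed.

Lemma cvg_dotl (T : Type) (F : set_system T) {FF : Filter F} (g : T -> H) u v :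
  g @ F --> u -> dot (g x) v @[x --> F] --> dot u v.
Proof.
move=> /cvg_rnormP cg; apply/cvg_rnormP => e e0.
(* Adding 1 covers the case [v = 0]. *)
have nv0 : 0 < rnorm v + 1 by rewrite ltr_wpDl ?rnorm_ge0.
have /cg : 0 < e / (rnorm v + 1) by rewrite divr_gt0.
apply: filterS => x; rewrite ltr_pdivlMr// rnorm_normc -dotBl.
apply: le_lt_trans; apply: le_trans (cauchy_schwarz _ _) _.
by rewrite ler_wpM2l ?rnorm_ge0// lerDl.
Qed.

Lemma cvg_dotr (T : Type) (F : set_system T) {FF : Filter F} (g : T -> H) u v :
  g @ F --> u -> dot v (g x) @[x --> F] --> dot v u.
Proof.
move=> cg; have := cvg_conj (@cvg_dotl _ _ _ g u v cg); rewrite -dotC.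
suff -> : (fun x => Num.conj (dot (g x) v)) = (fun x => dot v (g x)) by move=> /(_ FF FF).
by apply/funext => x; rewrite -dotC.
Qed.

Section Residual.
Context (B : nat -> H).

(** For orthonormal [B] this is the projection [Q_n] onto the orthogonal complement of the first [n]
    vectors. *)
Definition residual n u : H := u - \sum_(0 <= i < n) dot u (B i) *: B i.

Definition orthonormal_upto n :=
  forall i j, (i < n)%N -> (j < n)%N -> dot (B i) (B j) = (i == j)%:R.

Lemma gs_stepE n v :
  gs_step dot (mkseq B n) v = `|residual n v|^-1 *: residual n v.
Proof. by rewrite /gs_step /residual /mkseq big_map /index_iota subn0. Qed.

Lemma residual0 n : residual n 0 = 0.
Proof. by rewrite /residual big1 ?subrr// => i _; rewrite dot0l scale0r. Qed.

Lemma residualD n u v : residual n (u + v) = residual n u + residual n v.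
Proof.
rewrite /residual addrACA -opprD -big_split/=.
by congr (_ - _); apply: eq_bigr => i _; rewrite dotDl scalerDl.
Qed.

Lemma residualZ n c u : residual n (c *: u) = c *: residual n u.
Proof.
rewrite /residual scalerBr scaler_sumr; congr (_ - _).
by apply: eq_bigr => i _; rewrite dotZl scalerA.
Qed.

Lemma residualB n u v : residual n (u - v) = residual n u - residual n v.
Proof. by rewrite -scaleN1r residualD residualZ scaleN1r. Qed.

Lemma residual_sum n (I : Type) (r : seq I) (P : pred I) (F : I -> H) :
  residual n (\sum_(i <- r | P i) F i) = \sum_(i <- r | P i) residual n (F i).
Proof.
by elim/big_rec2: _ => [|i x y _ <-]; rewrite ?residual0// residualD.
Qed.

(** Self-adjointness holds for any family [B]. It later moves the residual between [f] and the
    kernel. *)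
Lemma residual_adjoint n u v : dot u (residual n v) = dot (residual n u) v.
Proof.
rewrite /residual dotBr dotBl dot_suml dot_sumr; congr (_ - _).
by apply: eq_bigr => i _; rewrite dotZl dotZr -dotC mulrC.
Qed.

Lemma dot_residual n u j : orthonormal_upto n -> (j < n)%N ->
  dot (residual n u) (B j) = 0.
Proof.
move=> on jn; rewrite /residual dotBl dot_suml.
rewrite (bigD1_seq j) ?mem_index_iota ?iota_uniq//= dotZl on// eqxx mulr1.
rewrite big_seq_cond big1 ?addr0 ?subrr// => i /andP[].
rewrite mem_index_iota => /= i_n ij.
by rewrite dotZl on// (negPf ij) mulr0.
Qed.

Lemma rnorm_sum_orthonormal N (d : nat -> Cplx R) m n : orthonormal_upto N ->
  (n <= N)%N ->
  rnorm (\sum_(m <= i < n) d i *: B i) ^+ 2 = \sum_(m <= i < n) normc (d i) ^+ 2.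
Proof.
move=> on; elim: n => [|n IH] nN; first by rewrite !big_geq// rnorm0 expr0n.
have [mn|nm] := leqP m n; last by rewrite !big_geq// rnorm0 expr0n.
rewrite !big_nat_recr//= rnorm_pythagoras ?IH 1?ltnW//.
  congr (_ + _); rewrite rnormZ exprMn -[RHS]mulr1; congr (_ * _).
  by apply: (@complexI R); rewrite -dot_rnorm on// eqxx.
rewrite dot_suml big_seq_cond big1// => i /andP[].
rewrite mem_index_iota => /andP[_ i_n] _.
by rewrite dotZl dotZr on ?ltn_eqF ?mulr0// (ltn_trans i_n).
Qed.

Lemma bessel n u : orthonormal_upto n ->
  rnorm (residual n u) ^+ 2 + \sum_(0 <= i < n) normc (dot u (B i)) ^+ 2 =
  rnorm u ^+ 2.
Proof.
move=> on; rewrite -(rnorm_sum_orthonormal _ _ on)// -rnorm_pythagoras.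
  by rewrite subrK.
rewrite dot_sumr big_seq_cond big1// => i /andP[].
rewrite mem_index_iota => /= i_n _.
by rewrite dotZr dot_residual// mulr0.
Qed.

Lemma residual_le n u : orthonormal_upto n -> rnorm (residual n u) <= rnorm u.
Proof.
move=> on; rewrite -(@ler_pXn2r _ 2) ?nnegrE ?rnorm_ge0// -(bessel u on).
by rewrite lerDl sumr_ge0// => i _; rewrite sqr_ge0.
Qed.

Lemma cvg_residual n (T : Type) (F : set_system T) {FF : Filter F}
    (g : T -> H) u :
  orthonormal_upto n -> g @ F --> u -> residual n (g x) @[x --> F] --> residual n u.
Proof.
move=> on /cvg_rnormP cg; apply/cvg_rnormP => e /cg; apply: filterS => x.
by rewrite -residualB; apply: le_lt_trans; exact: residual_le.
Qed.

Lemma residualS n u : orthonormal_upto n.+1 ->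
  residual n.+1 u = residual n u - dot (residual n u) (B n) *: B n.
Proof.
move=> on; rewrite {1}/residual big_nat_recr//= opprD addrA; congr (_ - _ *: _).
rewrite /residual dotBl dot_suml big_seq_cond big1 ?subr0// => i /andP[].
rewrite mem_index_iota => /= i_n _.
by rewrite dotZl on ?ltn_eqF ?mulr0// ltnS ltnW.
Qed.

(** Bessel bounds the series of squared coefficients, which therefore converges; the squared norm of
    a block of the vector series is the corresponding block of that real series. *)
Lemma is_cvg_orthonormal_series u : (forall n, orthonormal_upto n) ->
  cvgn (series (fun n => dot u (B n) *: B n)).
Proof.
move=> on; pose a n : R := normc (dot u (B n)) ^+ 2.
have ca : cvgn (series a).
  apply: nondecreasing_is_cvgn.
    by apply: nondecreasing_series => i _ _; rewrite sqr_ge0.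
  exists (rnorm u ^+ 2) => _ [n _ <-].
  by rewrite -(bessel u (on n)) lerDr sqr_ge0.
apply: rnorm_cauchy_cvg => e e0.
have e20 : 0 < e ^+ 2 by rewrite exprn_gt0.
(* A block is a difference of two partial sums, each within [e ^+ 2 / 2] of the limit. *)
have e2' : 0 < e ^+ 2 / 2 by rewrite divr_gt0.
move/cvgrPdist_lt : ca => /(_ _ e2')[N _ aN].
exists N => n Nn; rewrite sub_series_geq//.
rewrite -(@ltr_pXn2r _ 2) ?nnegrE ?rnorm_ge0 ?(ltW e0)//.
rewrite (rnorm_sum_orthonormal _ _ (on n))//.
have := aN n Nn; have := aN N (leqnn N) => /=.
rewrite -(sub_series_geq a Nn) !ltr_norml => /andP[h1 h2] /andP[h3 h4]; lra.
Qed.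

Lemma coef_orthonormal_cvg0 u : (forall n, orthonormal_upto n) ->
  normc (dot u (B n)) @[n --> \oo] --> 0.
Proof.
move=> on; have /cvg_series_cvg_0/cvg_rnormP c0 := @is_cvg_orthonormal_series u on.
apply/cvgrPdist_lt => e /c0; apply: filterS => n.
rewrite !sub0r rnormN normrN ger0_norm ?normc_ge0// rnormZ.
suff -> : rnorm (B n) = 1 by rewrite mulr1.
apply/eqP; rewrite -(@eqrXn2 _ 2) ?rnorm_ge0// expr1n; apply/eqP.
by apply: (@complexI R); rewrite -dot_rnorm (on n.+1)// eqxx.
Qed.

End Residual.

(** * Gram-Schmidt for an independent sequence *)

Section GramSchmidt.
Context (v B : nat -> H).
Hypotheses (B_gs : forall n, B n = gs_step dot (mkseq B n) (v n))
  (v_indep : forall n, lin_indep (mkseq v n)).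

Definition in_span n u := exists c : nat -> Cplx R, u = \sum_(0 <= i < n) c i *: v i.

Lemma in_spanS n u : in_span n u -> in_span n.+1 u.
Proof.
move=> [c ->]; exists (fun i => if i == n then 0 else c i).
rewrite big_nat_recr//= eqxx scale0r addr0 !big_mkord.
by apply: eq_bigr => i _; rewrite ltn_eqF.
Qed.

Lemma in_spanD n a u w : in_span n u -> in_span n w -> in_span n (a *: u + w).
Proof.
move=> [c ->] [d ->]; exists (fun i => a * c i + d i).
rewrite scaler_sumr -big_split/=.
by apply: eq_bigr => i _; rewrite scalerDl scalerA.
Qed.

Lemma in_span0 n : in_span n 0.
Proof. by exists (fun=> 0); rewrite big1// => i _; rewrite scale0r. Qed.

Lemma in_span_sum n m (c : nat -> Cplx R) (F : nat -> H) :
  (forall i, (i < m)%N -> in_span n (F i)) ->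
  in_span n (\sum_(0 <= i < m) c i *: F i).
Proof.
elim: m => [|m IH] h; first by rewrite big_nil; exact: in_span0.
rewrite big_nat_recr//= addrC; apply: in_spanD; first exact: h.
by apply: IH => i im; apply: h; rewrite ltnS ltnW.
Qed.

Lemma in_span_gen n : in_span n.+1 (v n).
Proof.
exists (fun i => (i == n)%:R); rewrite big_nat_recr//= eqxx scale1r.
by rewrite big_mkord big1 ?add0r// => i _; rewrite ltn_eqF// scale0r.
Qed.

Lemma in_span_gs n i : (i < n)%N -> in_span n (B i).
Proof.
elim: n i => [//|n IH] i; rewrite ltnS leq_eqVlt => /predU1P[->|/IH]; last exact: in_spanS.
rewrite B_gs gs_stepE -[X in in_span _ X]addr0.
apply: in_spanD (in_span0 _).
rewrite /residual -scaleN1r addrC; apply: in_spanD (in_span_gen _).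
by apply: in_span_sum => j jn; exact/in_spanS/IH.
Qed.

Lemma lin_indep_mkseq n (d : nat -> Cplx R) :
  \sum_(0 <= i < n) d i *: v i = 0 -> forall i, (i < n)%N -> d i = 0.
Proof.
move=> d0 i i_n; have i_lt : (i < size (mkseq v n))%N by rewrite size_mkseq.
have := v_indep (c := fun j : 'I_(size (mkseq v n)) => d j) _ (Ordinal i_lt).
apply; rewrite -(big_mkord xpredT (fun j => d j *: (mkseq v n)`_j)) size_mkseq.
rewrite -[RHS]d0; apply: eq_big_nat => j /andP[_ jn].
by rewrite nth_mkseq.
Qed.

(** The subtracted projection lies in the span of the earlier [v i], so a zero residual would be a
    linear relation with coefficient 1 on [v n]. Thus [gs_step] never divides by zero. *)
Lemma residual_gs_neq0 n : residual B n (v n) != 0.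
Proof.
apply/eqP => r0.
have [c cE] : in_span n (\sum_(0 <= i < n) dot (v n) (B i) *: B i).
  by apply: in_span_sum => i; exact: in_span_gs.
pose d i := if i == n then 1 else - c i.
suff /lin_indep_mkseq/(_ n (ltnSn n)) : \sum_(0 <= i < n.+1) d i *: v i = 0.
  by rewrite /d eqxx => /eqP; rewrite oner_eq0.
rewrite big_nat_recr//= {2}/d eqxx scale1r -[RHS]r0 /residual cE addrC.
congr (_ + _); rewrite -sumrN; apply: eq_big_nat => i /andP[_ i_n].
by rewrite /d ltn_eqF// scaleNr.
Qed.

Lemma orthonormal_gs n : orthonormal_upto B n.
Proof.
elim: n => [//|n IH].
have r0 : 0 < rnorm (residual B n (v n)) by rewrite rnorm_gt0 residual_gs_neq0.
have BnE : B n = `|residual B n (v n)|^-1 *: residual B n (v n).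
  by rewrite -gs_stepE -B_gs.
have Bn_orth j : (j < n)%N -> dot (B n) (B j) = 0.
  by move=> jn; rewrite BnE dotZl dot_residual// mulr0.
move=> i j; rewrite !ltnS leq_eqVlt => /predU1P[->|i_n];
  rewrite leq_eqVlt => /predU1P[->|jn]; last exact: IH.
- rewrite eqxx dot_rnorm BnE rnormZ normcV normc_rnorm mulVf ?gt_eqF//.
  by rewrite expr1n.
- by rewrite Bn_orth// gtn_eqF.
- by rewrite dotC Bn_orth// rmorph0 ltn_eqF.
Qed.

(** At stage [n] the residual of [v n] is a multiple of [B n], so stage [n + 1] removes it
    completely; a residual that is zero stays zero. *)
Lemma residual_gs_eq0 n i : (i < n)%N -> residual B n (v i) = 0.
Proof.
elim: n i => [//|n IH] i; rewrite ltnS leq_eqVlt residualS; last exact: orthonormal_gs.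
move=> /predU1P[->|/IH ->]; last by rewrite dot0l scale0r subrr.
have nr0 : `|residual B n (v n)| != 0 by rewrite normr_eq0 residual_gs_neq0.
rewrite B_gs gs_stepE dotZr -dot_norm scalerA.
set r := `|_| in nr0 *.
have -> : Num.conj r^-1 = r^-1.
  by apply: (@conj_Creal R[i]); rewrite realV; exact: (@normr_real (Cplx R)).
rewrite (_ : r^-1 * r ^+ 2 * r^-1 = 1) ?scale1r ?subrr//.
by field.
Qed.

End GramSchmidt.
End Dot.

(** * Maximal selection *)

Section MaximalSelection.
Context {R : realType} {H : completeNormedModType (Cplx R)}.
Context {E : set (Cplx R)} {dot : {dot H for Num.conj}}.
Context {ev : H -> Cplx R -> Cplx R} {k : Cplx R -> H}.
Context (H_rkhs : analytic_rkhs E dot ev k) (k_indep : kernels_independent E k).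
Context (a : nat -> Cplx R) (a_in_E : forall n, E (a n)).
Context (B : nat -> H).
Context (B_gs : forall n, mkseq B n = gram_schmidt dot (ktilde k (mkseq a n))).

Let dot_norm : induces_norm dot := rkhs_norm H_rkhs.

(** The kernel vector attached to [a n]: counting only the earlier occurrences gives the
    multiplicity minus one. *)
Definition node n : H := dbar k (count_mem (a n) (mkseq a n)) (a n).

(** The witness [j] is the position of occurrence number [i + 1] of [x]. *)
Lemma count_mkseq_lt x i n : (i < count_mem x (mkseq a n))%N ->
  exists2 j, (j < n)%N & a j = x /\ count_mem x (mkseq a j) = i.
Proof.
elim: n => [//|n IH]; rewrite mkseqS -cats1 count_cat /= addn0.
have [lt_i _|le_i] := ltnP i (count_mem x (mkseq a n)).
  by have [j jn jP] := IH lt_i; exists j => //; rewrite ltnS ltnW.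
case: eqP => [ax|_] /=; last by rewrite addn0 ltnNge le_i.
by rewrite addn1 ltnS => ge_i; exists n => //; split=> //; apply/eqP; rewrite eqn_leq le_i.
Qed.

Lemma ktilde_mkseq n : ktilde k (mkseq a n) = mkseq node n.
Proof.
rewrite /ktilde size_mkseq; apply/eq_in_map => i; rewrite mem_iota add0n => /= i_n.
rewrite /multiplicity nth_mkseq// /mkseq -map_take take_iota (minn_idPl i_n).
by rewrite -/(mkseq a i.+1) mkseqS -cats1 count_cat /= eqxx addn0 addn1.
Qed.

(** Peeling the last step off the fold in [B_gs] gives the recursion on which the Gram-Schmidt
    lemmas rest. *)
Lemma gs_node n : B n = gs_step dot (mkseq B n) (node n).
Proof.
have := B_gs n.+1; rewrite ktilde_mkseq !mkseqS /gram_schmidt foldl_rcons.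
by rewrite -/(gram_schmidt dot _) -ktilde_mkseq -B_gs => /rcons_inj[].
Qed.

Lemma node_indep n : lin_indep (mkseq node n).
Proof.
rewrite -ktilde_mkseq; apply: k_indep => x /mapP[i _ ->]; exact: a_in_E.
Qed.

Lemma orthonormal_B n : orthonormal_upto dot B n.
Proof. exact: (orthonormal_gs dot_norm gs_node (@node_indep)). Qed.

(** Derivatives of order below the number of occurrences of [x] are themselves earlier nodes, hence
    lie in the span already projected away. *)
Lemma residual_dbar n x i : (i < count_mem x (mkseq a n))%N ->
  residual dot B n (dbar k i x) = 0.
Proof.
move=> /count_mkseq_lt[j jn [<- <-]].
exact: (residual_gs_eq0 dot_norm gs_node (@node_indep) jn).
Qed.

Lemma residual_kernel n x : x \in mkseq a n -> residual dot B n (k x) = 0.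
Proof.
rewrite -has_pred1 has_count => /residual_dbar; rewrite /dbar derive1n0.
by rewrite [Num.conj (Num.conj x)](@conjCK R[i]).
Qed.

Lemma next_BE n x : next_B dot k (mkseq a n) x =
  `|residual dot B n (k x)|^-1 *: residual dot B n (k x).
Proof. by rewrite /next_B -B_gs gs_stepE. Qed.

Lemma normc_dot_normalize f u :
  normc (dot f (`|u|^-1 *: u)) = (rnorm u)^-1 * normc (dot f u).
Proof. by rewrite dotZr normcM normc_conj normcV normc_rnorm. Qed.

(* The power of [b - a n] in front of the leading Taylor term of the kernel is
   normalized to a phase, which the modulus of the inner product ignores. *)
Lemma next_B_cvg n f (b : nat -> Cplx R) :
  (forall j, b j \notin mkseq a n) -> b j @[j --> \oo] --> a n ->
  normc (dot f (next_B dot k (mkseq a n) (b j))) @[j --> \oo] -->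
  normc (dot f (B n)).
Proof.
move=> bs /cvg_conj ba; set m := count_mem (a n) (mkseq a n).
have [G [cG kE]] := analytic_taylor m (rkhs_kernel_analytic H_rkhs (a_in_E n)).
pose r j := residual dot B n (G (Num.conj (b j))).
pose L := residual dot B n (m`!%:R^-1 *: node n).
have cr : r @ \oo --> L.
  apply: (cvg_residual dot_norm (@orthonormal_B n)).
  exact: cvg_comp ba cG.
have fact_neq0 : (m`!%:R^-1 : Cplx R) != 0.
  by rewrite invr_eq0 pnatr_eq0 -lt0n fact_gt0.
pose phi u := (rnorm u)^-1 * normc (dot f u).
have phiZ c u : c != 0 -> phi (c *: u) = phi u.
  move=> c0; have nc0 : normc c != 0 by rewrite gt_eqF// normc_gt0.
  rewrite /phi rnormZ dotZr normcM normc_conj invfM.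
  by rewrite mulrACA mulVf// mul1r.
have -> : normc (dot f (B n)) = phi L.
  by rewrite gs_node gs_stepE normc_dot_normalize /L residualZ phiZ.
(* [phi] is continuous only away from 0, so the limit vector must be nonzero. *)
have L_neq0 : L != 0.
  rewrite /L residualZ scaler_eq0 negb_or fact_neq0.
  exact: (residual_gs_neq0 gs_node (@node_indep)).
have phi_cvg : phi (r j) @[j --> \oo] --> phi L.
  apply: cvgM.
    by apply: cvgV; [rewrite rnorm_eq0|exact: cvg_rnorm].
  by apply: cvg_normc; apply: (cvg_dotr dot_norm).
apply: cvg_trans phi_cvg; apply: near_eq_cvg.
have [N _ near_kE] := ba _ kE; exists N => // j /near_kE /= kbE.
rewrite next_BE normc_dot_normalize -/(phi _).
have : k (b j) = \sum_(i < m) ((Num.conj (b j) - Num.conj (a n)) ^+ i / i`!%:R) *: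
    dbar k i (a n) + (Num.conj (b j) - Num.conj (a n)) ^+ m *: G (Num.conj (b j)).
  by rewrite -[LHS]/(k (b j)) -{1}[b j](@conjCK R[i]) kbE.
move=> ->.
rewrite residualD residual_sum big1 ?add0r; last first.
  by move=> i _; rewrite residualZ residual_dbar ?scaler0.
rewrite residualZ phiZ//.
(* For [m = 0] the scalar is 1, even when [b j = a n]. For [m > 0] the point [a n] is among the
   earlier ones, which [b j] avoids, so the base of the power is nonzero. *)
have [m0|m_gt0] := posnP m; first by rewrite m0 expr0 oner_neq0.
rewrite expf_neq0// subr_eq0; apply/eqP => /(congr1 Num.conj).
rewrite [Num.conj (Num.conj (b j))](@conjCK R[i]).
rewrite [Num.conj (Num.conj (a n))](@conjCK R[i]) => ba_eq.
by have := bs j; rewrite ba_eq -has_pred1 has_count m_gt0.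
Qed.

Lemma dot_next_B_le n f x :
  normc (dot f (next_B dot k (mkseq a n) x)) <= rnorm f.
Proof.
rewrite next_BE normc_dot_normalize.
(* With a zero residual the convention [0^-1 = 0] makes the left side vanish. *)
have [->|r0] := eqVneq (residual dot B n (k x)) 0.
  by rewrite rnorm0 invr0 mul0r rnorm_ge0.
rewrite mulrC ler_pdivrMr ?rnorm_gt0//; exact: cauchy_schwarz.
Qed.

Lemma maximal_selection_le f n x : maximal_selection E dot k f a -> E x ->
  normc (dot (residual dot B n f) (k x)) <=
  normc (dot f (B n)) * rnorm (k x).
Proof.
move=> /(_ n)/=[b [bE ba b_sup]] Ex.
have bs j : b j \notin mkseq a n by have [_ /negP] := bE j.
(* The supremum and [normc (dot f (B n))] are limits of the same sequence along [b]. *)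
have supE : sup [set normc (dot f (next_B dot k (mkseq a n) x))
    | x in E `\` [set` mkseq a n]] = normc (dot f (B n)).
  have := cvg_lim (@Rhausdorff R) (@next_B_cvg n f b bs ba).
  rewrite (cvg_lim (@Rhausdorff R) b_sup); apply.
rewrite -residual_adjoint.
(* Earlier points are excluded from the supremum, but there the kernel has zero residual and the
   inequality is trivial. *)
have [xs|xs] := boolP (x \in mkseq a n).
  rewrite residual_kernel//.
  by rewrite dotC dot0l rmorph0 normc0 mulr_ge0 ?normc_ge0 ?rnorm_ge0.
have [->|r0] := eqVneq (residual dot B n (k x)) 0.
  by rewrite dotC dot0l rmorph0 normc0 mulr_ge0 ?normc_ge0 ?rnorm_ge0.
have nr0 : 0 < rnorm (residual dot B n (k x)) by rewrite rnorm_gt0.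
have : normc (dot f (next_B dot k (mkseq a n) x)) <= normc (dot f (B n)).
  (* [sup] dominates the values only for a bounded set; the bound is [rnorm f]. *)
  rewrite -supE; apply: ub_le_sup.
    by exists (rnorm f) => _ [y _ <-]; exact: dot_next_B_le.
  by exists x => //; split=> //; exact/negP.
rewrite next_BE normc_dot_normalize mulrC ler_pdivrMr// => /le_trans; apply.
rewrite ler_wpM2l ?normc_ge0//.
exact: (residual_le dot_norm _ (@orthonormal_B n)).
Qed.

Lemma maximal_selection_expansion f : maximal_selection E dot k f a ->
  series (fun n => dot f (B n) *: B n) @ \oo --> f.
Proof.
move=> msp.
have := is_cvg_orthonormal_series dot_norm (u := f) (@orthonormal_B).
set g := limn _ => cg.
suff : f - g = 0 by move=> /subr0_eq {2}->.
apply: (rkhs_inj H_rkhs) => x Ex; rewrite !(rkhs_reproducing H_rkhs)// dot0l.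
have cr : residual dot B n f @[n --> \oo] --> f - g.
  by apply: cvgB cg; exact: cvg_cst.
have c1 : normc (dot (residual dot B n f) (k x)) @[n --> \oo] -->
    normc (dot (f - g) (k x)).
  by apply: cvg_normc; apply: (cvg_dotl dot_norm).
apply: eq0_normc.
have c2 : normc (dot f (B n)) * rnorm (k x) @[n --> \oo] --> (0 : R).
  rewrite -[0](mul0r (rnorm (k x))); apply: cvgM; last exact: cvg_cst.
  exact: (coef_orthonormal_cvg0 dot_norm f (@orthonormal_B)).
apply/eqP; rewrite eq_le normc_ge0 andbT.
apply: (ler_cvg_to c1 c2); apply: nearW => n; exact: maximal_selection_le.
Qed.

End MaximalSelection.

Unset Implicit Arguments.
Set Strict Implicit.

Theorem theorem3p5 (R : realType) (E : set (Cplx R)) (E_open : open E)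
  (E_connected : connected E)
  (H : completeNormedModType (Cplx R)) (dot : {dot H for Num.conj})
  (ev : H -> Cplx R -> Cplx R) (k : Cplx R -> H)
  (H_rkhs : analytic_rkhs E dot ev k)
  (k_indep : kernels_independent E k)
  (vanishing : boundary_vanishing E dot k)
  (f : H) (a : nat -> Cplx R) (a_in_E : forall n, E (a n))
  (a_msp : maximal_selection E dot k f a)
  (B : nat -> H)
  (B_gs : forall n, mkseq B n = gram_schmidt dot (ktilde k (mkseq a n))) :
  series (fun n => dot f (B n) *: B n) @ \oo --> f.
Proof.
exact: (maximal_selection_expansion H_rkhs k_indep a_in_E B_gs a_msp).
Qed.
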